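(* Let $F_n$ be the free group on $\{x_1,\ldots,x_n\}$. For all $n \geq 1$, the $\mathbb{Z}[\mathbb{Z}^n]$-module $[F_n,F_n]^{\mathrm{ab}}$ has a sequence $$0 = M_0 \subset M_1 \subset \cdots \subset M_{n-1} = [F_n,F_n]^{\mathrm{ab}}$$ of $\mathbb{Z}[\mathbb{Z}^n]$-submodules such that, as $\mathbb{Z}[\mathbb{Z}^n]$-modules, $$M_k/M_{k-1} \cong \left(\mathbb{Z}\left[\mathbb{Z}^{n-k+1}\right]\right)^{\oplus (n-k)}$$ for $1 \leq k \leq n-1$.
   Context: For a group $G$, $G^{\mathrm{ab}}$ denotes its abelianization. The conjugation action of $F_n$ on $[F_n,F_n]$ induces an action of $F_n$ on $[F_n,F_n]^{\mathrm{ab}}$ that factors through $F_n/[F_n,F_n] = \mathbb{Z}^n$ (whose standard basis is the images of $x_1,\ldots,x_n$), making $[F_n,F_n]^{\mathrm{ab}}$ into a $\mathbb{Z}[\mathbb{Z}^n]$-module. For $1 \leq m \leq n$, the group ring $\mathbb{Z}[\mathbb{Z}^m]$ is regarded as a $\mathbb{Z}[\mathbb{Z}^n]$-module via the projection $\mathbb{Z}^n \rightarrow \mathbb{Z}^m$ onto the final $m$ coordinates. *)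

(* Defs.v *)
From HB Require Import structures.
From mathcomp Require Import all_boot all_order all_algebra finmap.
From mathcomp Require Import boolp.
From mathcomp.multinomials Require Import monalg.

Set Implicit Arguments.
Unset Strict Implicit.
Unset Printing Implicit Defensive.

Import GRing.Theory.
Local Open Scope ring_scope.
Local Open Scope quotient_scope.

(* A letter (x, false) stands for x and (x, true) for its inverse; elements of
   the free group are the reduced words. *)
Section FreeGroup.
Variable X : choiceType.
Local Notation letter := (X * bool)%type.
Implicit Types (l : letter) (u v w : seq letter).

Definition letter_inv l : letter := (l.1, ~~ l.2).

Definition reduced w : bool := sorted (fun l1 l2 => l2 != letter_inv l1) w.

(* left multiplication of a reduced word by one letter *)
Definition push l w : seq letter :=
  if w is l' :: w' then if l' == letter_inv l then w' else l :: w else [:: l].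

Definition word_mul v w : seq letter := foldr push w v.

Definition word_inv w : seq letter := rev [seq letter_inv l | l <- w].

Lemma letter_invK : involutive letter_inv.
Proof. by case=> x b; rewrite /letter_inv /= negbK. Qed.

Lemma reduced_behead l w : reduced (l :: w) -> reduced w.
Proof. exact: path_sorted. Qed.

Lemma reduced_push l w : reduced w -> reduced (push l w).
Proof.
case: w => [|l' w] //= rw; case: ifPn => [_|ne] /=; first exact: path_sorted rw.
by rewrite /reduced /= ne.
Qed.

Lemma pushK l w : reduced w -> push (letter_inv l) (push l w) = w.
Proof.
case: w => [|l' w] /=; first by rewrite letter_invK eqxx.
case: ifPn => [/eqP->|_] rw; last by rewrite /= letter_invK eqxx.
case: w rw => [|l2 w] //= /andP[ne _].
by rewrite (negPf ne).
Qed.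

Lemma pushVK l w : reduced w -> push l (push (letter_inv l) w) = w.
Proof. by move=> rw; rewrite -{1}(letter_invK l) pushK. Qed.

Lemma push_reduced l w : reduced (l :: w) -> push l w = l :: w.
Proof. by case: w => [|l' w] //= /andP[/negPf-> _]. Qed.

Lemma reduced_mul v w : reduced w -> reduced (word_mul v w).
Proof. by move=> rw; elim: v => //= l v; apply: reduced_push. Qed.

Lemma word_mul_push l v w : reduced v -> reduced w ->
  word_mul (push l v) w = push l (word_mul v w).
Proof.
case: v => [|l' v] //= rv rw; case: ifPn => [/eqP->|_] //.
by rewrite pushVK //; apply: reduced_mul.
Qed.

Lemma word_mulA u v w : reduced v -> reduced w ->
  word_mul u (word_mul v w) = word_mul (word_mul u v) w.
Proof.
move=> rv rw; elim: u => //= l u ->.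
by rewrite word_mul_push //; apply: reduced_mul.
Qed.

Lemma word_mulw1 w : reduced w -> word_mul w [::] = w.
Proof.
elim: w => //= l w IHw rw.
by rewrite IHw ?push_reduced //; apply: path_sorted rw.
Qed.

Lemma word_inv_cons l w : word_inv (l :: w) = rcons (word_inv w) (letter_inv l).
Proof. by rewrite /word_inv /= rev_cons. Qed.

Lemma word_mulVwK w v : reduced v -> word_mul (word_inv w) (word_mul w v) = v.
Proof.
elim: w v => //= l w IHw v rv.
rewrite word_inv_cons /word_mul foldr_rcons -/(word_mul _ _) -/(word_mul _ _).
by rewrite pushK ?IHw //; apply: reduced_mul.
Qed.

Lemma word_invK : involutive word_inv.
Proof.
move=> w; rewrite /word_inv map_rev revK -map_comp -[RHS]map_id.
by apply: eq_map => l; apply: letter_invK.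
Qed.

Lemma reduced_inv w : reduced w -> reduced (word_inv w).
Proof.
rewrite /reduced /word_inv rev_sorted sorted_map; apply: sub_sorted.
move=> l1 l2 /=; apply: contra => /eqP->.
by rewrite !letter_invK.
Qed.

Definition free_group : Type := {w : seq letter | reduced w}.

HB.instance Definition _ := SubChoice.on free_group.

Definition free_one : free_group := Sub [::] isT.
Definition free_mul (u v : free_group) : free_group :=
  Sub (word_mul (val u) (val v)) (reduced_mul _ (valP v)).
Definition free_inv (u : free_group) : free_group :=
  Sub (word_inv (val u)) (reduced_inv (valP u)).

Lemma free_mulA : associative free_mul.
Proof. by move=> u v w; apply: val_inj; apply: word_mulA; apply: valP. Qed.
Lemma free_mul1g : left_id free_one free_mul.
Proof. by move=> u; apply: val_inj. Qed.
Lemma free_mulg1 : right_id free_one free_mul.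
Proof. by move=> u; apply: val_inj; apply: word_mulw1; apply: valP. Qed.
Lemma free_mulVg : left_inverse free_one free_inv free_mul.
Proof.
move=> u; apply: val_inj => /=.
by rewrite -[X in word_mul _ X](word_mulw1 (valP u)) word_mulVwK.
Qed.
Lemma free_mulgV : right_inverse free_one free_inv free_mul.
Proof.
move=> u; rewrite -{1}[u](_ : free_inv (free_inv u) = u) ?free_mulVg //.
by apply: val_inj; apply: word_invK.
Qed.

HB.instance Definition _ := isGroup.Build free_group
  free_mulA free_mul1g free_mulg1 free_mulVg free_mulgV.

Definition gen (x : X) : free_group := Sub [:: (x, false)] isT.

Lemma free_group_ind (P : free_group -> Prop) :
    P 1%g -> (forall x (g : free_group), P g -> P (gen x * g)%g) ->
    (forall x (g : free_group), P g -> P ((gen x)^-1 * g)%g) ->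
  forall g, P g.
Proof.
move=> P1 Pgen PgenV [w]; elim: w => [|[x b] w IHw] rw.
  by congr P: P1; apply: val_inj.
pose g : free_group := exist _ w (reduced_behead rw).
have Pg : P g by apply: IHw.
have -> : exist _ ((x, b) :: w) rw = ((if b then (gen x)^-1 else gen x) * g)%g.
  by apply: val_inj; rewrite /= -[LHS]push_reduced //; case: (b).
by case: (b); [apply: PgenV | apply: Pgen].
Qed.

End FreeGroup.

Section FreeGroupUniversal.
Local Open Scope group_scope.
Variables (X : choiceType) (G : groupType) (f : X -> G).

Definition letter_val (l : X * bool) : G := if l.2 then (f l.1)^-1 else f l.1.

Definition free_lift (w : free_group X) : G :=
  foldr (fun l g => letter_val l * g) 1 (val w).

Lemma letter_valV l : letter_val (letter_inv l) = (letter_val l)^-1.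
Proof. by case: l => x [] //=; rewrite /letter_val /= invgK. Qed.

Lemma free_liftM (u v : free_group X) :
  free_lift (u * v) = free_lift u * free_lift v.
Proof.
rewrite /free_lift [val (u * v)]/=; case: u => u ru /=; clear ru.
have pushE l w : foldr (fun l g => letter_val l * g) 1 (push l w)
    = letter_val l * foldr (fun l g => letter_val l * g) 1 w.
  case: w => [|l' w] //=; case: ifPn => [/eqP->|_] //.
  by rewrite letter_valV mulVKg.
elim: u => [|l u IHu] /=; first by rewrite mul1g.
by rewrite pushE IHu mulgA.
Qed.

Lemma free_lift_gen x : free_lift (gen x) = f x.
Proof. by rewrite /free_lift /= mulg1. Qed.

Lemma free_lift_uniq (h : free_group X -> G) :
    {morph h : u v / u * v} -> (forall x, h (gen x) = f x) -> h =1 free_lift.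
Proof.
move=> hM hgen.
have h1 : h 1 = 1 by apply: (mulgI (h 1)); rewrite -hM !mulg1.
have hV u : h u^-1 = (h u)^-1.
  by apply: (mulgI (h u)); rewrite -hM !mulgV.
elim/free_group_ind => [|x u IHu|x u IHu]; first by rewrite h1.
  by rewrite hM free_liftM IHu hgen free_lift_gen.
by rewrite hM free_liftM IHu hV hgen {2}/free_lift /= mulg1.
Qed.

End FreeGroupUniversal.

Section Derived.
Local Open Scope group_scope.
Variable G : groupType.

Inductive in_derived : G -> Prop :=
| in_derived_comm x y : in_derived [~ x, y]
| in_derived1 : in_derived 1
| in_derivedM x y : in_derived x -> in_derived y -> in_derived (x * y)
| in_derivedV x : in_derived x -> in_derived x^-1.

Definition derived : {pred G} := fun x => `[< in_derived x >].

Lemma derivedP x : reflect (in_derived x) (x \in derived).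
Proof. exact: asboolP. Qed.

Lemma derived_comm x y : [~ x, y] \in derived.
Proof. by apply/derivedP; apply: in_derived_comm. Qed.

Lemma derived_group_closed : group_closed derived.
Proof.
split; first by apply/derivedP; apply: in_derived1.
move=> x y /derivedP Dx /derivedP Dy; apply/derivedP.
by apply: in_derivedM => //; apply: in_derivedV.
Qed.

Lemma derived1 : 1 \in derived.
Proof. exact: derived_group_closed.1. Qed.

Lemma derivedM x y : x \in derived -> y \in derived -> x * y \in derived.
Proof. exact: (group_closedM derived_group_closed). Qed.

Lemma derivedV x : x \in derived -> x^-1 \in derived.
Proof. exact: (group_closedV derived_group_closed). Qed.

Definition derived_group : Type := {x : G | x \in derived}.
HB.instance Definition _ := SubChoice.on derived_group.
HB.instance Definition _ :=
  SubChoice_isSubGroup.Build G derived derived_group derived_group_closed.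

Lemma derivedJ x g : x \in derived -> g * x / g \in derived.
Proof.
move=> Dx; have -> : g * x / g = x * [~ x, g^-1].
  by rewrite /commg /conjg invgK -!mulgA mulVKg.
by rewrite derivedM ?derived_comm.
Qed.

Definition ab_equiv (x y : G) : bool := x / y \in derived.

Lemma ab_equiv_is_equiv : equiv_class_of ab_equiv.
Proof.
split=> [x|x y|y x z]; rewrite /ab_equiv.
- by rewrite mulgV derived1.
- by apply/idP/idP => /derivedV; rewrite invgF.
- by move=> Dxy Dyz; rewrite -(mulgVK y x) -mulgA derivedM.
Qed.

Canonical ab_equivRel := EquivRelPack ab_equiv_is_equiv.
Canonical ab_encModRel := defaultEncModRel ab_equiv.

Definition abelianization := {eq_quot ab_equiv}.

HB.instance Definition _ : EqQuotient G ab_equiv abelianization :=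
  EqQuotient.on abelianization.
HB.instance Definition _ := Choice.on abelianization.

Definition ab (x : G) : abelianization := \pi_abelianization x.

Lemma ab_eqP x y : (ab x == ab y) = (x / y \in derived).
Proof. by rewrite /ab eqmodE. Qed.

Lemma ab_repr (a : abelianization) : ab (repr a) = a.
Proof. exact: reprK. Qed.

Lemma eq_abM x y x' y' : ab x = ab x' -> ab y = ab y' ->
  ab (x * y) = ab (x' * y').
Proof.
move=> /eqP + /eqP; rewrite !ab_eqP => Dx Dy; apply/eqP; rewrite ab_eqP.
have -> : x * y / (x' * y') = (x / x') * (x' * (y / y') / x').
  by rewrite invgM !mulgA mulgVK.
by rewrite derivedM ?derivedJ.
Qed.

(* the group law of the abelianization, written additively *)
Definition ab_zero : abelianization := ab 1.
Definition ab_opp (a : abelianization) : abelianization := ab (repr a)^-1.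
Definition ab_add (a b : abelianization) : abelianization :=
  ab (repr a * repr b).

Lemma ab_addE x y : ab_add (ab x) (ab y) = ab (x * y).
Proof. by apply: eq_abM; rewrite ab_repr. Qed.

Lemma ab_addA : associative ab_add.
Proof.
move=> a b c; rewrite -[a]ab_repr -[b]ab_repr -[c]ab_repr.
by rewrite !ab_addE mulgA.
Qed.
Lemma ab_addC : commutative ab_add.
Proof.
move=> a b; rewrite -[a]ab_repr -[b]ab_repr !ab_addE.
apply/eqP; rewrite ab_eqP.
set x := repr a; set y := repr b.
have -> : x * y / (y * x) = [~ x^-1, y^-1].
  by rewrite /commg /conjg !invgK invgM !mulgA.
exact: derived_comm.
Qed.
Lemma ab_add0 : left_id ab_zero ab_add.
Proof. by move=> a; rewrite -[a]ab_repr ab_addE mul1g. Qed.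
Lemma ab_addN : left_inverse ab_zero ab_opp ab_add.
Proof. by move=> a; rewrite -{2}[a]ab_repr ab_addE mulVg. Qed.

HB.instance Definition _ := GRing.isZmodule.Build abelianization
  ab_addA ab_addC ab_add0 ab_addN.

Lemma abM x y : ab (x * y) = (ab x + ab y)%R.
Proof. by rewrite -ab_addE. Qed.

Lemma ab1 : ab 1 = 0%R.
Proof. by []. Qed.

Lemma abV x : ab x^-1 = (- ab x)%R.
Proof. by apply/eqP; rewrite -addr_eq0 -abM mulVg. Qed.

End Derived.

(* The integral group ring of an additively written abelian group A: finitely
   supported functions A -> int, with << k *g a >> the multiple k of the basis
   element a. Its product is not the one of [monalg], which is restricted to
   monoids without nontrivial units. *)
Definition group_ring (A : zmodType) : Type := {malg int[A]}.
HB.instance Definition _ (A : zmodType) :=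
  GRing.Zmodule.on (group_ring A).

Definition gr_basis (A : zmodType) (a : A) : group_ring A := << 1 *g a >>.

Section GrLift.
Variables (A V : zmodType).
Implicit Types (f : A -> V) (r : group_ring A).

(* the Z-linear extension of a function defined on the basis A *)
Definition gr_lift f r : V :=
  \sum_(a <- msupp (r : {malg int[A]})) f a *~ mcoeff a r.

Lemma gr_liftEw f r (d : {fset A}) : (msupp (r : {malg int[A]}) `<=` d)%fset ->
  gr_lift f r = \sum_(a <- d) f a *~ mcoeff a r.
Proof.
move=> sub; rewrite /gr_lift; apply: big_fset_incl => // a _ /mcoeff_outdom ->.
by rewrite mulr0z.
Qed.

Lemma gr_lift_is_additive f : zmod_morphism (gr_lift f).
Proof.
move=> r s.
pose d := (msupp (r : {malg int[A]}) `|` msupp (s : {malg int[A]}))%fset.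
rewrite (@gr_liftEw f (r - s) d) ?msuppB_le //.
rewrite (@gr_liftEw f r d) ?fsubsetUl // (@gr_liftEw f s d) ?fsubsetUr //.
rewrite -sumrB; apply: eq_bigr => a _.
by rewrite [X in _ *~ X](@mcoeffB A int) mulrzBr.
Qed.
HB.instance Definition _ f :=
  GRing.isZmodMorphism.Build (group_ring A) V (gr_lift f)
    (gr_lift_is_additive f).

Lemma gr_lift_basis f a : gr_lift f (gr_basis a) = f a.
Proof.
rewrite (@gr_liftEw f _ [fset a]%fset) ?msuppU_le // big_seq_fset1.
by rewrite mcoeffUU mulr1z.
Qed.

Lemma eq_gr_lift f f' : f =1 f' -> gr_lift f =1 gr_lift f'.
Proof. by move=> eqf r; apply: eq_bigr => a _; rewrite eqf. Qed.

Lemma gr_liftDl f f' r :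
  gr_lift (fun a => f a + f' a) r = gr_lift f r + gr_lift f' r.
Proof. by rewrite -big_split; apply: eq_bigr => a _; rewrite mulrzDl. Qed.

End GrLift.

Lemma gr_sum_basis (A : zmodType) (r : group_ring A) :
  r = \sum_(a <- msupp (r : {malg int[A]})) gr_basis a *~ mcoeff a r.
Proof.
rewrite [LHS](@monalgE A int); apply: (@eq_bigr {malg int[A]}) => a _.
rewrite -[LHS]/(mkmalgU a (mcoeff a r)) -[mcoeff a r in LHS]intz.
exact: (raddfMz (@mkmalgU A int a)).
Qed.

Lemma gr_ind (A : zmodType) (P : group_ring A -> Prop) :
    (forall a, P (gr_basis a)) -> (forall r s, P r -> P s -> P (r - s)) ->
  forall r, P r.
Proof.
move=> Pbasis PB r.
have P0 : P 0 by rewrite -(subrr (gr_basis 0)); apply: PB.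
have PN s : P s -> P (- s) by rewrite -[- s]add0r; apply: PB.
have PD s t : P s -> P t -> P (s + t).
  by move=> Ps Pt; rewrite -[t]opprK; apply/PB/PN.
have PMn s n : P s -> P (s *+ n).
  by move=> Ps; elim: n => // n IHn; rewrite mulrS; apply: PD.
rewrite [r]gr_sum_basis; apply: (big_ind P) => // a _.
case: (mcoeff a r) => n; first exact: PMn.
by rewrite NegzE mulrNz; apply/PN/PMn.
Qed.

Section GroupRing.
Variable A : zmodType.
Local Notation ZA := (group_ring A).
Implicit Types r s t : ZA.

Definition gr_one : ZA := gr_basis 0.

(* the biadditive product with [a] * [b] = [a + b] *)
Definition gr_mul r s : ZA :=
  gr_lift (fun a => gr_lift (fun b => gr_basis (a + b)) s) r.

Lemma gr_mul_basis a b : gr_mul (gr_basis a) (gr_basis b) = gr_basis (a + b).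
Proof. by rewrite /gr_mul !gr_lift_basis. Qed.

Lemma gr_mulDl : left_distributive gr_mul +%R.
Proof. by move=> r s t; rewrite /gr_mul raddfD. Qed.

Lemma gr_mulDr : right_distributive gr_mul +%R.
Proof.
move=> r s t; rewrite /gr_mul -gr_liftDl.
by apply: eq_gr_lift => a; rewrite raddfD.
Qed.

Lemma gr_mulBl r s t : gr_mul (r - s) t = gr_mul r t - gr_mul s t.
Proof. exact: raddfB. Qed.

Lemma gr_mulBr r s t : gr_mul r (s - t) = gr_mul r s - gr_mul r t.
Proof.
by apply: (addIr (gr_mul r t)); rewrite -gr_mulDr !subrK.
Qed.

Lemma gr_mulA : associative gr_mul.
Proof.
move=> r s t.
elim/gr_ind: r => [a|r1 r2 IH1 IH2]; last by rewrite !gr_mulBl IH1 IH2.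
elim/gr_ind: s => [b|s1 s2 IH1 IH2].
  elim/gr_ind: t => [c|t1 t2 IH1 IH2]; last by rewrite !gr_mulBr IH1 IH2.
  by rewrite !gr_mul_basis addrA.
by rewrite gr_mulBr !gr_mulBl gr_mulBr IH1 IH2.
Qed.

Lemma gr_mulC : commutative gr_mul.
Proof.
move=> r s.
elim/gr_ind: r => [a|r1 r2 IH1 IH2]; last by rewrite gr_mulBl gr_mulBr IH1 IH2.
elim/gr_ind: s => [b|s1 s2 IH1 IH2]; last by rewrite gr_mulBl gr_mulBr IH1 IH2.
by rewrite !gr_mul_basis addrC.
Qed.

Lemma gr_mul1 : left_id gr_one gr_mul.
Proof.
elim/gr_ind => [a|r s IH1 IH2]; last by rewrite gr_mulBr IH1 IH2.
by rewrite gr_mul_basis add0r.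
Qed.

Lemma gr_one_neq0 : gr_one != 0.
Proof. by rewrite /gr_one /gr_basis (@monalgU_eq0 A int). Qed.

HB.instance Definition _ := GRing.Zmodule_isComNzRing.Build ZA
  gr_mulA gr_mulC gr_mul1 gr_mulDl gr_one_neq0.

Lemma gr_basis0 : gr_basis 0 = 1 :> ZA.
Proof. by []. Qed.

Lemma gr_basisD a b : gr_basis (a + b) = gr_basis a * gr_basis b :> ZA.
Proof. exact/esym/gr_mul_basis. Qed.
End GroupRing.

Section GrMap.
Variables (A B : zmodType) (f : {additive A -> B}).

Definition gr_map : group_ring A -> group_ring B :=
  gr_lift (fun a => gr_basis (f a)).

Lemma gr_map_basis a : gr_map (gr_basis a) = gr_basis (f a).
Proof. exact: gr_lift_basis. Qed.

HB.instance Definition _ := GRing.Additive.on gr_map.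

Lemma gr_mapB r s : gr_map (r - s) = gr_map r - gr_map s.
Proof. exact: raddfB. Qed.

Lemma gr_map_is_monoid_morphism : monoid_morphism gr_map.
Proof.
split=> [|r s]; first by rewrite -gr_basis0 gr_map_basis raddf0.
elim/gr_ind: r => [a|r1 r2 IH1 IH2]; last first.
  by rewrite mulrBl !gr_mapB mulrBl IH1 IH2.
elim/gr_ind: s => [b|s1 s2 IH1 IH2]; last first.
  by rewrite mulrBr !gr_mapB mulrBr IH1 IH2.
by rewrite -gr_basisD !gr_map_basis raddfD gr_basisD.
Qed.
HB.instance Definition _ := GRing.isMonoidMorphism.Build
  (group_ring A) (group_ring B) gr_map gr_map_is_monoid_morphism.
End GrMap.

Section DerivedAb.
Variable G : groupType.

Definition derived_ab : Type := abelianization (derived_group G).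
HB.instance Definition _ := GRing.Zmodule.on derived_ab.

Section Conj.
Local Open Scope group_scope.

Definition conj_derived (g : G) (w : derived_group G) : derived_group G :=
  Sub (g * val w / g) (derivedJ g (valP w)).

Lemma conj_derivedM g : {morph conj_derived g : u v / u * v}.
Proof.
by move=> u v; apply: val_inj; rewrite /= !mulgA mulgVK.
Qed.

Lemma conj_derivedMl g h w :
  conj_derived (g * h) w = conj_derived g (conj_derived h w).
Proof. by apply: val_inj; rewrite /= invgM !mulgA. Qed.

Lemma conj_derived1 w : conj_derived 1 w = w.
Proof. by apply: val_inj; rewrite /= invg1 mulg1 mul1g. Qed.

Lemma conj_derived_is1 g : conj_derived g 1 = 1.
Proof. by apply: (mulgI (conj_derived g 1)); rewrite -conj_derivedM !mulg1. Qed.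

Lemma conj_derivedV g w : conj_derived g w^-1 = (conj_derived g w)^-1.
Proof.
by apply: (mulgI (conj_derived g w)); rewrite -conj_derivedM !mulgV conj_derived_is1.
Qed.

Lemma ab_conj_derivedr g u v : ab u = ab v ->
  ab (conj_derived g u) = ab (conj_derived g v).
Proof.
move=> /eqP; rewrite ab_eqP => /derivedP Duv; apply/eqP; rewrite ab_eqP.
rewrite -conj_derivedV -conj_derivedM; move: (u / v) Duv => w {u v}.
elim=> [x y||x y _ IHx _ IHy|x _ IHx].
- have -> : conj_derived g [~ x, y] = [~ conj_derived g x, conj_derived g y].
    by rewrite /commg /conjg !conj_derivedM !conj_derivedV.
  exact: derived_comm.
- by rewrite conj_derived_is1 derived1.
- by rewrite conj_derivedM derivedM.
- by rewrite conj_derivedV derivedV.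
Qed.

Lemma ab_conj_derivedl g h w : ab g = ab h ->
  ab (conj_derived g w) = ab (conj_derived h w).
Proof.
move=> /eqP; rewrite ab_eqP => Dgh.
pose d : derived_group G := exist _ (g / h) Dgh.
have -> : g = val d * h by rewrite /= mulgVK.
rewrite conj_derivedMl; move: (conj_derived h w) => {}w.
have -> : conj_derived (val d) w = d * w / d by apply: val_inj.
by rewrite !abM abV addrAC subrr add0r.
Qed.

(* The class of g u g^-1 for any g representing a: the conjugation action on
   [G, G]^ab descends to G^ab (see [derived_actE]), which turns [G, G]^ab into
   a module over Z[G^ab]. *)
Definition derived_act (a : abelianization G) (u : derived_ab) : derived_ab :=
  ab (conj_derived (repr a) (repr u)).

Lemma derived_actE g w : derived_act (ab g) (ab w) = ab (conj_derived g w).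
Proof.
rewrite /derived_act (@ab_conj_derivedl (repr (ab g)) g) ?ab_repr //.
by apply: ab_conj_derivedr; rewrite ab_repr.
Qed.

End Conj.

Lemma derived_actD a : {morph derived_act a : u v / u + v}.
Proof.
move=> u v; rewrite -[a]ab_repr -[u]ab_repr -[v]ab_repr.
by rewrite -[ab (repr u) + _]abM !derived_actE conj_derivedM abM.
Qed.

Lemma derived_act_comp a b u :
  derived_act (a + b) u = derived_act a (derived_act b u).
Proof.
rewrite -[a]ab_repr -[b]ab_repr -[u]ab_repr -abM !derived_actE.
by rewrite conj_derivedMl.
Qed.

Lemma derived_act0 u : derived_act 0 u = u.
Proof. by rewrite -ab1 -[u]ab_repr derived_actE conj_derived1. Qed.

Definition derived_scale (r : group_ring (abelianization G)) (u : derived_ab) :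
  derived_ab := gr_lift (fun a => derived_act a u) r.

Lemma derived_scale_basis a u : derived_scale (gr_basis a) u = derived_act a u.
Proof. exact: gr_lift_basis. Qed.

Lemma derived_scaleDr : right_distributive derived_scale +%R.
Proof.
move=> r u v; rewrite /derived_scale -gr_liftDl.
by apply: eq_gr_lift => a; rewrite derived_actD.
Qed.

Lemma derived_scaleDl u : {morph derived_scale^~ u : r s / r + s}.
Proof. by move=> r s; rewrite /derived_scale raddfD. Qed.

Lemma derived_scaleBl r s u :
  derived_scale (r - s) u = derived_scale r u - derived_scale s u.
Proof. by rewrite /derived_scale raddfB. Qed.

Lemma derived_scaleBr r u v :
  derived_scale r (u - v) = derived_scale r u - derived_scale r v.
Proof. by apply: (addIr (derived_scale r v)); rewrite -derived_scaleDr !subrK. Qed.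

Lemma derived_scale1 : left_id 1 derived_scale.
Proof. by move=> u; rewrite -gr_basis0 derived_scale_basis derived_act0. Qed.

Lemma derived_scaleA r s u :
  derived_scale r (derived_scale s u) = derived_scale (r * s) u.
Proof.
elim/gr_ind: r => [a|r1 r2 IH1 IH2]; last first.
  by rewrite mulrBl !derived_scaleBl IH1 IH2.
elim/gr_ind: s => [b|s1 s2 IH1 IH2]; last first.
  by rewrite mulrBr !derived_scaleBl derived_scaleBr IH1 IH2.
by rewrite -gr_basisD !derived_scale_basis derived_act_comp.
Qed.

HB.instance Definition _ := GRing.Zmodule_isLmodule.Build
  (group_ring (abelianization G)) derived_ab
  derived_scaleA derived_scale1 derived_scaleDr derived_scaleDl.

Lemma derived_ab_conjE (g : G) (w : derived_group G) :
  gr_basis (ab g) *: (ab w : derived_ab) = ab (conj_derived g w).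
Proof. by rewrite -derived_actE -derived_scale_basis. Qed.
End DerivedAb.

Definition lmod_iso (R : pzRingType) (U V : lmodType R) : Prop :=
  exists f : {linear U -> V}, bijective f.

(* V regarded as an R-module through h : R -> S *)
Definition restriction (R S : pzRingType) (h : {rmorphism R -> S})
  (V : lmodType S) : Type := V.

Section Restriction.
Variables (R S : pzRingType) (h : {rmorphism R -> S}) (V : lmodType S).
Local Notation restriction := (restriction h V).

HB.instance Definition _ := GRing.Zmodule.on restriction.

Definition restriction_scale (r : R) (v : restriction) : restriction :=
  h r *: (v : V).

Lemma restriction_scaleA r s v :
  restriction_scale r (restriction_scale s v) = restriction_scale (r * s) v.
Proof. by rewrite /restriction_scale scalerA rmorphM. Qed.
Lemma restriction_scale1 : left_id 1 restriction_scale.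
Proof. by move=> v; rewrite /restriction_scale rmorph1 scale1r. Qed.
Lemma restriction_scaleDr : right_distributive restriction_scale +%R.
Proof. by move=> r u v; rewrite /restriction_scale scalerDr. Qed.
Lemma restriction_scaleDl v : {morph restriction_scale^~ v : r s / r + s}.
Proof. by move=> r s; rewrite /restriction_scale rmorphD scalerDl. Qed.

HB.instance Definition _ := GRing.Zmodule_isLmodule.Build R restriction
  restriction_scaleA restriction_scale1 restriction_scaleDr restriction_scaleDl.
End Restriction.

Section Submodule.
Variables (R : pzRingType) (V : lmodType R) (M : submodClosed V).

Definition submodule : Type := {x : V | x \in M}.
HB.instance Definition _ := SubChoice.on submodule.
HB.instance Definition _ := [SubChoice_isSubLmodule of submodule by <:].
End Submodule.

Section QuotientModule.
Variables (R : pzRingType) (V : lmodType R) (N : submodClosed V).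

Definition quot_equiv (x y : V) : bool := x - y \in N.

Lemma submodN x : x \in N -> - x \in N.
Proof. by move=> Nx; rewrite -scaleN1r rpredZ. Qed.

Lemma quot_equiv_is_equiv : equiv_class_of quot_equiv.
Proof.
split=> [x|x y|y x z]; rewrite /quot_equiv.
- by rewrite subrr rpred0.
- by apply/idP/idP => /submodN; rewrite opprB.
- by move=> Nxy Nyz; rewrite -(subrK y x) -addrA rpredD.
Qed.

Canonical quot_equivRel := EquivRelPack quot_equiv_is_equiv.
Canonical quot_encModRel := defaultEncModRel quot_equiv.

Definition quot_module := {eq_quot quot_equiv}.
HB.instance Definition _ : EqQuotient V quot_equiv quot_module :=
  EqQuotient.on quot_module.
HB.instance Definition _ := Choice.on quot_module.

Definition quot_class (x : V) : quot_module := \pi_quot_module x.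

Lemma quot_classP x y : (quot_class x == quot_class y) = (x - y \in N).
Proof. by rewrite /quot_class eqmodE. Qed.

Lemma quot_class_repr q : quot_class (repr q) = q.
Proof. exact: reprK. Qed.

Definition quot_zero : quot_module := quot_class 0.
Definition quot_opp (p : quot_module) : quot_module := quot_class (- repr p).
Definition quot_add (p q : quot_module) : quot_module :=
  quot_class (repr p + repr q).
Definition quot_scale (r : R) (p : quot_module) : quot_module :=
  quot_class (r *: repr p).

Lemma quot_reprB x : repr (quot_class x) - x \in N.
Proof. by rewrite -quot_classP quot_class_repr. Qed.

Lemma quot_addE x y :
  quot_add (quot_class x) (quot_class y) = quot_class (x + y).
Proof.
by apply/eqP; rewrite quot_classP opprD addrACA rpredD ?quot_reprB.
Qed.

Lemma quot_oppE x : quot_opp (quot_class x) = quot_class (- x).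
Proof. by apply/eqP; rewrite quot_classP -opprD submodN ?quot_reprB. Qed.

Lemma quot_scaleE r x : quot_scale r (quot_class x) = quot_class (r *: x).
Proof. by apply/eqP; rewrite quot_classP -scalerBr rpredZ ?quot_reprB. Qed.

Let quotE := (quot_addE, quot_oppE, quot_scaleE).

Lemma quot_addA : associative quot_add.
Proof.
move=> p q s; rewrite -[p]quot_class_repr -[q]quot_class_repr.
by rewrite -[s]quot_class_repr !quotE addrA.
Qed.
Lemma quot_addC : commutative quot_add.
Proof.
move=> p q; rewrite -[p]quot_class_repr -[q]quot_class_repr.
by rewrite !quotE addrC.
Qed.
Lemma quot_add0 : left_id quot_zero quot_add.
Proof. by move=> p; rewrite -[p]quot_class_repr !quotE add0r. Qed.
Lemma quot_addN : left_inverse quot_zero quot_opp quot_add.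
Proof. by move=> p; rewrite -[p]quot_class_repr !quotE addNr. Qed.

HB.instance Definition _ := GRing.isZmodule.Build quot_module
  quot_addA quot_addC quot_add0 quot_addN.

Lemma quot_scaleA r s p :
  quot_scale r (quot_scale s p) = quot_scale (r * s) p.
Proof. by rewrite -[p]quot_class_repr !quotE scalerA. Qed.
Lemma quot_scale1 : left_id 1 quot_scale.
Proof. by move=> p; rewrite -[p]quot_class_repr !quotE scale1r. Qed.
Lemma quot_scaleDr : right_distributive quot_scale +%R.
Proof.
move=> r p q; rewrite -[p]quot_class_repr -[q]quot_class_repr.
by rewrite -[quot_class _ + _]/(quot_add _ _) -[RHS]/(quot_add _ _)
  !quotE scalerDr.
Qed.
Lemma quot_scaleDl p : {morph quot_scale^~ p : r s / r + s}.
Proof.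
move=> r s; rewrite -[p]quot_class_repr.
by rewrite -[RHS]/(quot_add _ _) !quotE scalerDl.
Qed.

HB.instance Definition _ := GRing.Zmodule_isLmodule.Build R quot_module
  quot_scaleA quot_scale1 quot_scaleDr quot_scaleDl.

Lemma quot_class_is_linear : linear quot_class.
Proof.
by move=> r x y; rewrite -[r *: quot_class x]/(quot_scale _ _)
  -[RHS]/(quot_add _ _) !quotE.
Qed.
HB.instance Definition _ := GRing.isLinear.Build R V quot_module *:%R
  quot_class quot_class_is_linear.
End QuotientModule.

Section Subquotient.
Variables (R : pzRingType) (V : lmodType R) (M N : submodClosed V).

Definition submod_in_pred (x : submodule M) : bool := val x \in N.

Lemma submod_in_closed : submod_closed submod_in_pred.
Proof.
split=> [|r x y]; first by rewrite -[_ \in _]/(val 0 \in N) raddf0 rpred0.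
rewrite -![_ \in submod_in_pred]/(val _ \in N) => Nx Ny.
by rewrite linearP /= rpredD ?rpredZ.
Qed.
HB.instance Definition _ := GRing.isSubmodClosed.Build R (submodule M)
  submod_in_pred submod_in_closed.

(* the submodule M :&: N of M, that is N when N is included in M *)
Definition submod_in : submodClosed (submodule M) :=
  GRing.SubmodClosed.clone R (submodule M) submod_in_pred _.

(* M / N, for N included in M *)
Definition subquotient : lmodType R := quot_module submod_in.
End Subquotient.

Local Notation Z_ n := 'rV[int]_n.

(* the identification Z^n = F_n / [F_n, F_n] sending the i-th standard basis
   vector to the class of x_i (bijective by [free_ab_bij]); [derived_ab F_n] is
   made a Z[Z^n]-module through it *)
Section FreeAb.
Variable n : nat.

Definition free_ab (v : Z_ n) : abelianization (free_group 'I_n) :=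
  \sum_i ab (gen i) *~ v 0 i.

Lemma free_ab_is_additive : zmod_morphism free_ab.
Proof.
move=> u v; rewrite /free_ab -sumrB; apply: eq_bigr => i _.
by rewrite !mxE mulrzBr.
Qed.
HB.instance Definition _ := GRing.isZmodMorphism.Build
  (Z_ n) (abelianization (free_group 'I_n)) free_ab free_ab_is_additive.

Local Notation F := (free_group 'I_n).

Lemma free_ab_delta i : free_ab (delta_mx 0 i) = ab (gen i).
Proof.
rewrite /free_ab (bigD1 i) //= mxE !eqxx big1 ?addr0 // => j ji.
by rewrite mxE (negPf ji) andbF.
Qed.

Definition exponents (u : F) : Z_ n :=
  \sum_(l <- val u) (if l.2 then - delta_mx 0 l.1 else delta_mx 0 l.1).

Lemma exponentsM (u v : F) : exponents (u * v)%g = exponents u + exponents v.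
Proof.
rewrite /exponents [val (u * v)%g]/=; case: u => u ru /=; clear ru.
elim: u => [|l u IHu] /=; first by rewrite big_nil add0r.
rewrite big_cons -addrA -IHu; case: (word_mul u _) => [|l' w] /=.
  by rewrite big_seq1 big_nil addr0.
case: ifPn => [/eqP->|_]; last by rewrite big_cons.
by rewrite big_cons; case: l => i [] /=; rewrite ?addNKr ?addKr.
Qed.

Lemma exponents1 : exponents 1%g = 0.
Proof. exact: big_nil. Qed.

Lemma exponentsV (u : F) : exponents u^-1%g = - exponents u.
Proof. by apply/eqP; rewrite -addr_eq0 -exponentsM mulVg exponents1. Qed.

Lemma exponents_derived (u : F) : u \in @derived F -> exponents u = 0.
Proof.
move=> /derivedP; elim=> [x y||x y _ IHx _ IHy|x _ IHx].
- rewrite /commg /conjg !exponentsM !exponentsV.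
  by rewrite [exponents x + _]addrC addKr addNr.
- exact: exponents1.
- by rewrite exponentsM IHx IHy addr0.
- by rewrite exponentsV IHx oppr0.
Qed.

Lemma exponents_ab (u v : F) : ab u = ab v -> exponents u = exponents v.
Proof.
move=> /eqP; rewrite ab_eqP => /exponents_derived/eqP.
by rewrite exponentsM exponentsV subr_eq0 => /eqP.
Qed.

Lemma exponents_gen i : exponents (gen i) = delta_mx 0 i.
Proof. exact: big_seq1. Qed.

Lemma free_ab_exponents (u : F) : free_ab (exponents u) = ab u.
Proof.
elim/free_group_ind: u => [|i u IHu|i u IHu].
- by rewrite exponents1 raddf0.
- by rewrite exponentsM raddfD /= IHu exponents_gen free_ab_delta abM.
- rewrite exponentsM raddfD /= IHu exponentsV exponents_gen raddfN /=.
  by rewrite free_ab_delta abM abV.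
Qed.

Definition ab_exponents (a : abelianization F) : Z_ n := exponents (repr a).

Lemma ab_exponentsE (u : F) : ab_exponents (ab u) = exponents u.
Proof. by apply: exponents_ab; rewrite ab_repr. Qed.

Lemma ab_exponents_is_additive : zmod_morphism ab_exponents.
Proof.
move=> a b; rewrite -[a in LHS]ab_repr -[b in LHS]ab_repr -abV -abM.
by rewrite ab_exponentsE exponentsM exponentsV.
Qed.
HB.instance Definition _ := GRing.isZmodMorphism.Build
  (abelianization F) (Z_ n) ab_exponents ab_exponents_is_additive.

Lemma free_ab_bij : bijective free_ab.
Proof.
exists ab_exponents => [v|a]; last by rewrite free_ab_exponents ab_repr.
rewrite /free_ab raddf_sum [RHS]row_sum_delta; apply: eq_bigr => i _.
by rewrite raddfMz /= ab_exponentsE exponents_gen -scaler_int intz.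
Qed.

Definition free_derived_ab : lmodType (group_ring (Z_ n)) :=
  restriction (gr_map free_ab) (derived_ab F).

Lemma free_derived_ab_genE (i : 'I_n) (w : derived_group F) :
  gr_basis (delta_mx 0 i : Z_ n) *: (ab w : free_derived_ab) =
  ab (conj_derived (gen i) w).
Proof.
rewrite -[LHS]/(gr_map free_ab (gr_basis (delta_mx 0 i)) *: (ab w : derived_ab F)).
by rewrite gr_map_basis /= free_ab_delta derived_ab_conjE.
Qed.
End FreeAb.

(* The projection Z^n -> Z^m onto the final m coordinates, through which
   Z[Z^m] is a Z[Z^n]-module. It is meant for m <= n; otherwise the truncated
   subtraction makes it pad with zeros. *)
Section LastCoords.
Variables n m : nat.

Definition last_coords (v : Z_ n) : Z_ m :=
  \row_(i < m) oapp (v 0) 0 (insub (n - m + i)%N).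

Lemma last_coordsE (v : Z_ n) (i : 'I_m) (j : 'I_n) :
  j = (n - m + i)%N :> nat -> last_coords v 0 i = v 0 j.
Proof. by move=> ji; rewrite mxE -ji valK. Qed.

Lemma last_coords_is_additive : zmod_morphism last_coords.
Proof.
by move=> u v; apply/rowP => i; rewrite !mxE; case: insub => [j|] /=;
  rewrite ?mxE ?subr0.
Qed.
HB.instance Definition _ := GRing.isZmodMorphism.Build
  (Z_ n) (Z_ m) last_coords last_coords_is_additive.

Definition last_group_ring : lmodType (group_ring (Z_ n)) :=
  restriction (gr_map last_coords) ((group_ring (Z_ m))^o).
End LastCoords.

(* Main.v *)
(* Write c_ij for the class of [x_i, x_j] and let M_k be the submodule spanned
   by the c_ij with i <= k. The Hall-Witt identity
     (y^-1 - 1)[x, z] = (x^-1 - 1)[y, z] + (z^-1 - 1)[x, y]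
   shows that x_1, ..., x_(k-1) act trivially on M_k / M_(k-1), so that this
   quotient is generated over Z[Z^(n-k+1)] by the n - k classes c_kj with j > k.
   They are independent: for j > k, the Fox derivative with respect to x_j,
   with coefficients in Z[Z^(n-k+1)], induces a linear map on [F_n, F_n]^ab
   which kills M_(k-1) and sends c_kl to a unit times (x_k - 1) if l = j and to
   0 otherwise, and x_k - 1 is not a zero divisor. *)
Require Import Defs.
From HB Require Import structures.
From mathcomp Require Import all_boot all_order all_algebra.
From mathcomp Require Import finmap boolp.
From mathcomp.multinomials Require Import monalg.

Set Implicit Arguments.
Unset Strict Implicit.
Unset Printing Implicit Defensive.

Import GRing.Theory.
Local Open Scope ring_scope.

(** * Isomorphisms from a common source, linear combinations and spans *)

Section LinearMaps.
Variable R : nzRingType.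

(** Both U and V are W modulo one and the same kernel. The map is [g] after a set-theoretic section
    of [f]; equality of the kernels makes it independent of the section, hence linear. *)
Lemma lmod_iso_surj (W U V : lmodType R) (f : {linear W -> U})
    (g : {linear W -> V}) :
    (forall u, exists w, f w = u) -> (forall v, exists w, g w = v) ->
    (forall w, f w = 0 <-> g w = 0) ->
  lmod_iso U V.
Proof.
move=> /choice[f' f'K] /choice[g' g'K] eq_ker.
have eq_fg w w' : f w = f w' <-> g w = g w'.
  split=> /eqP; rewrite -subr_eq0 -raddfB => /eqP /eq_ker /eqP;
  by rewrite raddfB subr_eq0 => /eqP.
pose h u := g (f' u).
have h_linear : linear h.
  by move=> a u v; rewrite /h -linearP; apply/eq_fg; rewrite linearP /= !f'K.
pose hL := GRing.isLinear.Build R U V *:%R h h_linear.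
pose hh : {linear U -> V} := HB.pack h hL.
exists hh; exists (fun v => f (g' v)) => [u|v] /=.
  by rewrite -[RHS]f'K; apply/eq_fg; rewrite g'K.
by rewrite -[RHS]g'K; apply/eq_fg; rewrite f'K.
Qed.

Variable V : lmodType R.

Definition lin_comb q (c : 'I_q -> V) (r : {ffun 'I_q -> R^o}) : V :=
  \sum_j (r j : R) *: c j.

Lemma lin_comb_is_linear q (c : 'I_q -> V) : linear (lin_comb c).
Proof.
move=> a r s; rewrite /lin_comb scaler_sumr -big_split; apply: eq_bigr => j _.
by rewrite !ffunE /= scalerA -scalerDl.
Qed.
HB.instance Definition _ q (c : 'I_q -> V) :=
  GRing.isLinear.Build R {ffun 'I_q -> R^o} V *:%R (lin_comb c)
    (lin_comb_is_linear c).

Lemma lin_comb_delta q (c : 'I_q -> V) a j :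
  lin_comb c [ffun i => if i == j then a else 0] = a *: c j.
Proof.
rewrite /lin_comb (bigD1 j) //= ffunE eqxx big1 ?addr0 // => i ij.
by rewrite ffunE (negPf ij) scale0r.
Qed.

Section Span.
Variable S : V -> Prop.

(** Sums grow one generator at a time, so an induction on membership treats a single term a x. *)
Inductive in_span : V -> Prop :=
| in_span0 : in_span 0
| in_spanP a x y : S x -> in_span y -> in_span (a *: x + y).

Definition span_pred : {pred V} := fun x => `[< in_span x >].

Lemma span_closed : submod_closed span_pred.
Proof.
split; first by apply/asboolP; apply: in_span0.
move=> a x y /asboolP Sx /asboolP Sy; apply/asboolP.
elim: Sx => [|b u v Su _ IH]; first by rewrite scaler0 add0r.
by rewrite scalerDr scalerA -addrA; apply: in_spanP.
Qed.
HB.instance Definition _ := GRing.isSubmodClosed.Build R V span_pred span_closed.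

Definition span : submodClosed V := GRing.SubmodClosed.clone R V span_pred _.

Lemma spanP x : reflect (in_span x) (x \in span).
Proof. exact: asboolP. Qed.

Lemma mem_span x : S x -> x \in span.
Proof.
move=> Sx; apply/spanP; rewrite -[x]addr0 -[x]scale1r.
exact/in_spanP/in_span0.
Qed.

Lemma span_sub (N : submodClosed V) :
  (forall x, S x -> x \in N) -> {subset span <= N}.
Proof.
move=> SN x /spanP; elim=> [|a u v Su _ IH]; first exact: rpred0.
apply: rpredD IH; apply: rpredZ; exact: SN.
Qed.
End Span.
End LinearMaps.

(** * Group rings and their modules *)

Lemma sub1_mul_eq0 (R : pzRingType) (a b x : R) :
  a = 1 -> (a - 1) * x - b * 0 = 0.
Proof. by move=> ->; rewrite subrr mul0r mulr0 subr0. Qed.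

(** Together with [sub1_mul_eq0], this evaluates the right-hand side of [partial_comm]: there for a
    generator that becomes trivial, here for the basis commutators. *)
Lemma mulr_if_sub0 (R : pzRingType) (a b : R) (c : bool) :
  a * (if c then 1 else 0) - b * 0 = if c then a else 0.
Proof. by case: c; rewrite ?mulr1 ?mulr0 subr0. Qed.

Section GroupRingLemmas.
Variable A : zmodType.
Implicit Type r : group_ring A.

Lemma mcoeff_gr_basisM a b r :
  mcoeff b (gr_basis a * r : {malg int[A]}) = mcoeff (b - a) (r : {malg int[A]}).
Proof.
elim/gr_ind: r => [c|r s IHr IHs]; last first.
  rewrite mulrBr (@mcoeffB A int b (gr_basis a * r) (gr_basis a * s)).
  by rewrite (@mcoeffB A int (b - a) r s) IHr IHs.
by rewrite -gr_basisD !mcoeffU addrC eq_sym -subr_eq eq_sym.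
Qed.

(* A finitely supported function invariant under translation by an element of
   infinite order vanishes. *)
Lemma gr_basis_sub1_reg a r :
  injective (fun i : nat => a *+ i) -> (gr_basis a - 1) * r = 0 -> r = 0.
Proof.
move=> a_inj /eqP; rewrite mulrBl mul1r subr_eq0 => /eqP ar.
have ari i : gr_basis (a *+ i) * r = r.
  elim: i => [|i IHi]; first by rewrite mulr0n gr_basis0 mul1r.
  by rewrite mulrS gr_basisD -mulrA IHi.
apply/eqP/contraT => /eqP r_neq0.
pose d := msupp (r : {malg int[A]}).
have [b bd] : exists b, b \in d.
  apply: contra_notP r_neq0 => no_b; apply/(@malgP A int) => b.
  rewrite mcoeff0; apply: mcoeff_outdom; apply/negP => bd.
  by apply: no_b; exists b.
pose s := [seq b + a *+ i | i <- iota 0 (size d).+1].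
have : (size s <= size d)%N.
  apply: uniq_leq_size => [|_ /mapP[i _ ->]].
    by rewrite map_inj_uniq ?iota_uniq // => i j /addrI /a_inj.
  move: bd; rewrite /d -!mcoeff_neq0; congr (_ != 0).
  by rewrite -[in RHS](ari i) mcoeff_gr_basisM addrK.
by rewrite size_map size_iota ltnn.
Qed.

Section Scale.
Variable V : lmodType (group_ring A).
Implicit Type v : V.

Lemma scale_gr_basis0 v : gr_basis 0 *: v = v.
Proof. by rewrite gr_basis0 scale1r. Qed.

Lemma scale_gr_basisD a b v :
  gr_basis (a + b) *: v = gr_basis a *: (gr_basis b *: v).
Proof. by rewrite gr_basisD scalerA. Qed.

Lemma scale_gr_basisNK a v : gr_basis (- a) *: (gr_basis a *: v) = v.
Proof. by rewrite -scale_gr_basisD addNr scale_gr_basis0. Qed.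

Lemma scale_gr_basisKN a v : gr_basis a *: (gr_basis (- a) *: v) = v.
Proof. by rewrite -scale_gr_basisD subrr scale_gr_basis0. Qed.

Lemma scale_gr_basis_eq0 a v : gr_basis a *: v = 0 -> v = 0.
Proof. by move=> av; rewrite -(scale_gr_basisNK a v) av scaler0. Qed.

Lemma scaler_comm_eq0 (r s : group_ring A) v : r *: v = 0 -> r *: (s *: v) = 0.
Proof. by move=> rv; rewrite scalerA mulrC -scalerA rv scaler0. Qed.

Lemma scale_gr_basisB1 a v : (gr_basis a - 1) *: v = gr_basis a *: v - v.
Proof. by rewrite scalerBl scale1r. Qed.

Lemma scale_gr_basis_subB (N : submodClosed V) a b v :
    gr_basis a *: v - v \in N -> gr_basis b *: v - v \in N ->
  gr_basis (a - b) *: v - v \in N.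
Proof.
move=> Na Nb; have := rpredZ (gr_basis (- b)) (rpredD Na (submodN Nb)).
rewrite opprB addrA subrK scalerBr scale_gr_basisNK -scale_gr_basisD.
by rewrite [- b + a]addrC.
Qed.

Lemma mem_scale_gr_basisB1 (N : submodClosed V) a v :
  (gr_basis a - 1) *: v \in N -> gr_basis a *: v - v \in N.
Proof. by rewrite scale_gr_basisB1. Qed.

Lemma scale_gr_basisB1_swap a b c u v w :
    v + gr_basis b *: u + gr_basis c *: w = u + gr_basis a *: v ->
  gr_basis c *: w = (gr_basis a - 1) *: v - (gr_basis b - 1) *: u.
Proof.
move=> /(canRL (addKr _)) ->; rewrite !scale_gr_basisB1 !opprD opprK.
by rewrite [u + _]addrC addrACA [- v + _]addrC.
Qed.

Lemma scale_gr_basis_jacobi a b c u v w w' :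
    w' = (gr_basis c - 1) *: w ->
    gr_basis a *: v + u = gr_basis b *: u + v + w' ->
  (gr_basis a - 1) *: v = (gr_basis b - 1) *: u + (gr_basis c - 1) *: w.
Proof.
move=> -> /(canRL (addrK _)); rewrite !scale_gr_basisB1 => ->.
by rewrite [LHS]addrAC [RHS]addrAC (addrAC _ v) addrK.
Qed.
End Scale.
End GroupRingLemmas.

(** * Induction on a coordinate subgroup of Z^n, and maps out of an abelianization *)

Lemma int_row_ind n k (P : 'rV[int]_n -> Prop) :
    P 0 -> (forall u w, P u -> P w -> P (u - w)) ->
    (forall l : 'I_n, (l < k)%N -> P (delta_mx 0 l)) ->
  forall v : 'rV[int]_n, (forall l : 'I_n, (k <= l)%N -> v 0 l = 0) -> P v.
Proof.
move=> P0 PB Pdelta v v0.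
have PN u : P u -> P (- u) by rewrite -[- u]sub0r; apply: PB.
have PD u w : P u -> P w -> P (u + w).
  by move=> Pu Pw; rewrite -[w]opprK; apply/PB/PN.
rewrite [v]row_sum_delta; apply: (big_ind P) => // l _.
have [kl|lk] := leqP k l; first by rewrite v0 // scale0r.
have PMn m : P (delta_mx 0 l *+ m).
  elim: m => // m IHm; rewrite mulrS; apply: PD => //; exact: Pdelta.
rewrite -[v 0 l]intz scaler_int; case: (v 0 l) => m; first exact: PMn.
by rewrite NegzE mulrNz; apply/PN/PMn.
Qed.

(** A homomorphism to an abelian group is zero on commutators; this lets Fox derivatives descend to
    [F, F]^ab. *)
Lemma additive_ab (G : groupType) (V : zmodType) (h : G -> V) :
    (forall x y, h (x * y)%g = h x + h y) ->
  forall x y, ab x = ab y -> h x = h y.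
Proof.
move=> hM x y /eqP; rewrite ab_eqP => /derivedP Dxy.
have h1 : h 1%g = 0 by apply: (addrI (h 1%g)); rewrite -hM mulg1 addr0.
have hV u : h u^-1%g = - h u by apply/eqP; rewrite -addr_eq0 -hM mulVg h1.
apply/eqP; rewrite -subr_eq0 -hV -hM; apply/eqP; elim: Dxy.
- move=> u v; rewrite /commg /conjg !hM !hV.
  by rewrite [h u + _]addrC addKr addNr.
- exact: h1.
- by move=> u v _ hu _ hv; rewrite hM hu hv addr0.
- by move=> u _ hu; rewrite hV hu oppr0.
Qed.

(** * Subquotients that are free over a quotient ring *)

Section SubquotientBasis.
Variables (R S : nzRingType) (h : {rmorphism R -> S}) (V : lmodType R).
Variables (M N : submodClosed V) (q : nat) (c : 'I_q -> V).

(** R^q maps onto M/N through the [c j] and onto S^q through [h]. The third hypothesis says that the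
    two kernels agree, so [lmod_iso_surj] applies. *)
Lemma subquotient_iso :
    (forall j, c j \in M) ->
    (forall x, x \in M -> exists r, lin_comb c r - x \in N) ->
    (forall r, lin_comb c r \in N <-> forall j, h (r j) = 0) ->
    (forall s, exists r, h r = s) ->
  lmod_iso (subquotient M N) {ffun 'I_q -> restriction h (S^o)}.
Proof.
move=> Mc c_gen c_free h_surj.
pose cM j : submodule M := exist _ (c j) (Mc j).
have val_comb r : val (lin_comb cM r) = lin_comb c r.
  by rewrite /lin_comb raddf_sum; apply: eq_bigr => j _; apply: GRing.valZ.
pose f : {linear {ffun 'I_q -> R^o} -> subquotient M N} :=
  @quot_class R (submodule M) (submod_in M N) \o lin_comb cM.
pose g0 (r : {ffun 'I_q -> R^o}) : {ffun 'I_q -> restriction h (S^o)} :=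
  [ffun j => h (r j)].
have g0_linear : linear g0.
  by move=> a r s; apply/ffunP => j; rewrite !ffunE rmorphD rmorphM.
pose g0L := GRing.isLinear.Build _ _ _ *:%R g0 g0_linear.
pose g : {linear {ffun 'I_q -> R^o} -> {ffun 'I_q -> restriction h (S^o)}} :=
  HB.pack g0 g0L.
apply: (@lmod_iso_surj R _ _ _ f g) => [u|v|r].
- rewrite -[u]quot_class_repr; case: (c_gen _ (valP (repr u))) => r Nr.
  exists r; apply/eqP; rewrite quot_classP.
  by rewrite -[_ \in _]/(val (_ - _) \in N) raddfB /= val_comb.
- have /choice[r0 hr0] : forall j, exists r, h r = v j.
    by move=> j; apply: h_surj.
  by exists [ffun j => r0 j]; apply/ffunP => j; rewrite !ffunE hr0.
have -> : (f r = 0) <-> (lin_comb c r \in N).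
  rewrite -val_comb -[X in X \in N]subr0 -(raddf0 (\val : submodule M -> V)).
  rewrite -raddfB -[_ \in N]/(_ \in submod_in M N) -quot_classP.
  by split => [fr|/eqP fr]; [apply/eqP|]; rewrite -/(f r) ?raddf0 //= fr raddf0.
rewrite c_free; split=> [hr|/ffunP gr j]; last by have := gr j; rewrite !ffunE.
by apply/ffunP => j; rewrite !ffunE.
Qed.
End SubquotientBasis.

(** * Image and kernel of Z[A] -> Z[B] *)

Section GrMapLemmas.
Variables (A B : zmodType) (p : {additive A -> B}).

Lemma restriction_gr_basisB1 a (x : restriction (gr_map p) ((group_ring B)^o)) :
  (gr_basis a - 1) *: x = (gr_basis (p a) - 1) * (x : group_ring B).
Proof.
rewrite -[LHS]/(gr_map p (gr_basis a - 1) * (x : group_ring B)).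
by rewrite rmorphB rmorph1 /= gr_map_basis.
Qed.

Variables (s : B -> A) (sK : cancel s p).

(** The set-theoretic section [s], extended Z-linearly, is a section of [gr_map p]. *)
Lemma gr_map_surj t : exists r, gr_map p r = t.
Proof.
exists (gr_lift (fun b => gr_basis (s b)) t).
elim/gr_ind: t => [b|t u IHt IHu]; last by rewrite !raddfB /= IHt IHu.
by rewrite gr_lift_basis gr_map_basis sK.
Qed.

(** The kernel of Z[A] -> Z[B] is the ideal generated by the [a] - 1 with p a = 0, and these send v
    into N. *)
Lemma gr_map_ker_scale (V : lmodType (group_ring A)) (N : submodClosed V) v r :
    (forall a, p a = 0 -> gr_basis a *: v - v \in N) ->
  gr_map p r = 0 -> r *: v \in N.
Proof.
move=> Na pr.
(* A claim valid for every r, hence open to induction: replacing each a by the representative s (p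
   a) of its class does not change r v modulo N. *)
suff : r *: v - gr_lift (fun b => gr_basis (s b)) (gr_map p r) *: v \in N.
  by rewrite pr raddf0 scale0r subr0.
elim/gr_ind: r {pr} => [a|r t IHr IHt].
  rewrite gr_map_basis gr_lift_basis.
  have := rpredZ (gr_basis (s (p a))) (Na (a - s (p a)) _).
  rewrite scalerBr -scale_gr_basisD [s (p a) + _]addrC subrK; apply.
  by rewrite raddfB /= sK subrr.
rewrite !raddfB /= !scalerBl opprD opprK addrACA; apply: rpredD => //.
by have := submodN IHt; rewrite opprB addrC.
Qed.
End GrMapLemmas.

(** * Fox derivatives as crossed homomorphisms *)

Section Fox.
Variables (X : choiceType) (A : zmodType) (V : lmodType (group_ring A)).
Variables (e : X -> A) (d : X -> V).
Local Notation letter := (X * bool)%type.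

Definition letter_exp (l : letter) : A := if l.2 then - e l.1 else e l.1.

(** The value -x^-1 d(x) on x^-1 is forced by the product rule applied to x^-1 x = 1. *)
Definition letter_fox (l : letter) : V :=
  if l.2 then - (gr_basis (- e l.1) *: d l.1) else d l.1.

Definition word_fox (w : seq letter) : V :=
  foldr (fun l v => letter_fox l + gr_basis (letter_exp l) *: v) 0 w.

(** The product rule persists when [push] cancels a letter, because the derivative of l l^-1 is
    0. *)
Lemma word_fox_push l w :
  word_fox (push l w) = letter_fox l + gr_basis (letter_exp l) *: word_fox w.
Proof.
case: w => [|l' w] //=; case: ifPn => [/eqP->|_] //=.
rewrite scalerDr; case: l => x [] /=; rewrite /letter_fox /letter_exp /=.
  by rewrite scale_gr_basisNK addKr.
by rewrite scalerN !scale_gr_basisKN addNKr.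
Qed.

Lemma word_fox_mul v w :
  word_fox (word_mul v w) =
  word_fox v + gr_basis (\sum_(l <- v) letter_exp l) *: word_fox w.
Proof.
elim: v => [|l v IHv]; first by rewrite big_nil scale_gr_basis0 add0r.
rewrite big_cons scale_gr_basisD [word_mul _ _]/= word_fox_push IHv /=.
by rewrite scalerDr addrA.
Qed.
End Fox.

Section FreeFox.
Variables (n : nat) (V : lmodType (group_ring 'rV[int]_n)) (d : 'I_n -> V).
Local Notation F := (free_group 'I_n).

(* The crossed homomorphism F_n -> V extending d, that is the Fox derivative
   with values in V. *)
Definition fox (u : F) : V := word_fox (delta_mx 0) d (val u).

Lemma fox_gen i : fox (gen i) = d i.
Proof. by rewrite /fox /= scaler0 addr0. Qed.

Lemma foxM (u v : F) : fox (u * v)%g = fox u + gr_basis (exponents u) *: fox v.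
Proof. exact: word_fox_mul. Qed.

Definition fox_ab (a : free_derived_ab n) : V := fox (val (repr a)).

(** On [F, F] the exponents vanish, so the crossed homomorphism is untwisted there and restricts to
    a homomorphism. *)
Lemma fox_derivedMl (w : derived_group F) (g : F) :
  fox (val w * g)%g = fox (val w) + fox g.
Proof. by rewrite foxM (exponents_derived (valP w)) scale_gr_basis0. Qed.

Lemma fox_abE (w : derived_group F) : fox_ab (ab w) = fox (val w).
Proof.
apply: (@additive_ab (derived_group F) _ (fun w => fox (val w))).
  by move=> x y; apply: fox_derivedMl.
exact: ab_repr.
Qed.

Lemma scale_ab (g : F) (w : derived_group F) :
  gr_basis (exponents g) *: (ab w : free_derived_ab n) = ab (conj_derived g w).
Proof.
rewrite -[LHS]/(gr_map (@free_ab n) (gr_basis _) *: (ab w : derived_ab F)).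
by rewrite gr_map_basis /= free_ab_exponents derived_ab_conjE.
Qed.

Lemma fox_ab_is_zmod_morphism : zmod_morphism fox_ab.
Proof.
move=> a b; apply: (addIr (fox_ab b)); rewrite subrK.
rewrite -[in RHS](subrK b a); move: (a - b) => {}a.
rewrite -[a]ab_repr -[b]ab_repr -[ab _ + ab _]abM.
by rewrite !fox_abE fox_derivedMl.
Qed.
HB.instance Definition _ := GRing.isZmodMorphism.Build
  (free_derived_ab n) V fox_ab fox_ab_is_zmod_morphism.

(** Differentiate both sides of (g w g^-1) g = g w; the conjugate lies in [F, F], so the left side
    is an untwisted sum. *)
Lemma fox_conj g (w : derived_group F) :
  fox (val (conj_derived g w)) = gr_basis (exponents g) *: fox (val w).
Proof.
apply: (addrI (fox g)); rewrite -foxM addrC -fox_derivedMl /=.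
by rewrite mulgVK.
Qed.

Lemma fox_ab_is_scalable : scalable fox_ab.
Proof.
elim/gr_ind => [v a|r s IHr IHs a]; last first.
  by rewrite !scalerBl raddfB /= IHr IHs.
have [g ->] : exists g : F, v = exponents g.
  have [f free_abK fK] := free_ab_bij n.
  exists (repr (free_ab v)); apply: (can_inj free_abK).
  by rewrite free_ab_exponents ab_repr.
by rewrite -[a]ab_repr scale_ab !fox_abE fox_conj.
Qed.
HB.instance Definition _ := GRing.isScalable.Build
  (group_ring 'rV[int]_n) (free_derived_ab n) V *:%R fox_ab fox_ab_is_scalable.
End FreeFox.

(** * Commutator identities in [F, F]^ab *)

Section Commutators.
Variable n : nat.
Local Notation F := (free_group 'I_n).
Local Notation V := (free_derived_ab n).

Definition comm_ab (x y : F) : V :=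
  ab (exist _ [~ x, y]%g (derived_comm x y) : derived_group F).

(** Differentiate both sides of y x [x, y] = x y and solve for the term of [x, y], which carries the
    unit of y x. *)
Lemma fox_comm (W : lmodType (group_ring 'rV[int]_n)) (d : 'I_n -> W) x y :
  gr_basis (exponents (y * x)%g) *: fox_ab d (comm_ab x y) =
  (gr_basis (exponents x) - 1) *: fox d y -
  (gr_basis (exponents y) - 1) *: fox d x.
Proof.
rewrite fox_abE; apply: scale_gr_basisB1_swap.
by rewrite -!foxM -commgC.
Qed.

Lemma comm_ab_sym x y : comm_ab y x = - comm_ab x y.
Proof.
rewrite /comm_ab -[RHS]abV; congr (ab _ : V); apply: val_inj => /=.
by rewrite invgR.
Qed.

(** This is [xy, z] = y^-1 [x, z] y [y, z]; since g acts by w -> g w g^-1, the exponent of y appears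
    negated. *)
Lemma comm_ab_Ml x y z : comm_ab (x * y)%g z =
  gr_basis (- exponents y) *: comm_ab x z + comm_ab y z.
Proof.
rewrite -exponentsV scale_ab -[RHS]abM; congr (ab _ : V); apply: val_inj => /=.
by rewrite /commg /conjg invgK invgM !mulgA !mulgK.
Qed.

Lemma comm_ab_derivedl (w : derived_group F) z :
  comm_ab (val w) z = (gr_basis (- exponents z) - 1) *: (ab w : V).
Proof.
apply: etrans (esym (scale_gr_basisB1 _ _)).
rewrite -exponentsV scale_ab addrC -[- _]abV -[RHS]abM.
congr (ab _ : V); apply: val_inj => /=.
by rewrite /commg /conjg invgK !mulgA; reflexivity.
Qed.

(** Expand [xy, z] in two ways, from x y and from y x [x, y]. The factor [x, y] acts trivially and
    contributes (z^-1 - 1)[x, y]. *)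
Lemma comm_ab_jacobi x y z :
  (gr_basis (- exponents y) - 1) *: comm_ab x z =
  (gr_basis (- exponents x) - 1) *: comm_ab y z +
  (gr_basis (- exponents z) - 1) *: comm_ab x y.
Proof.
pose w : derived_group F := exist _ [~ x, y]%g (derived_comm x y).
apply: (scale_gr_basis_jacobi (comm_ab_derivedl w z)).
apply: etrans (esym (comm_ab_Ml x y z)) _; rewrite (commgC x y).
apply: etrans (comm_ab_Ml (y * x)%g (val w) z) _; congr (_ + _).
rewrite (exponents_derived (valP w)) oppr0.
exact: etrans (scale_gr_basis0 _) (comm_ab_Ml y x z).
Qed.
End Commutators.

(** * The filtration by commutators of generators *)

Section Filtration.
Variable n : nat.
Local Notation F := (free_group 'I_n).
Local Notation V := (free_derived_ab n).

Lemma comm_ab_eq0 (x y : F) : [~ x, y]%g = 1%g -> comm_ab x y = 0.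
Proof.
move=> xy1; rewrite -[0]/(ab 1%g : V); congr (ab _ : V).
exact: val_inj.
Qed.

Lemma comm_ab_mem_left (N : submodClosed V) (y : F) :
  (forall i, comm_ab (gen i) y \in N) -> forall x, comm_ab x y \in N.
Proof.
move=> Ngen; elim/free_group_ind => [|i x Nx|i x Nx].
- by rewrite comm_ab_eq0 ?rpred0 // /commg /conjg invg1 !mul1g mulVg.
- by rewrite comm_ab_Ml rpredD ?rpredZ.
rewrite comm_ab_Ml rpredD ?rpredZ //.
(* Expanding [x_i^-1 x_i, y] = 0 shows that [x_i^-1, y] is a unit times -[x_i, y]. *)
have := comm_ab_Ml (gen i)^-1%g (gen i) y.
rewrite mulVg comm_ab_eq0; last by rewrite /commg /conjg invg1 !mul1g mulVg.
move=> /esym/(canRL (addrK _)); rewrite sub0r => E.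
rewrite -[comm_ab _ y](scale_gr_basisKN (exponents (gen i))).
by apply: rpredZ; rewrite E submodN.
Qed.

(** Reduce one argument of a commutator to generators, then the other by skew-symmetry; products and
    inverses of commutators then exhaust [F, F]. *)
Lemma derived_ab_mem (N : submodClosed V) :
  (forall i j, comm_ab (gen i) (gen j) \in N) -> forall u, u \in N.
Proof.
move=> Ngen u.
have Ncomm x y : comm_ab x y \in N.
  apply: comm_ab_mem_left => i; rewrite -[X in X \in _]opprK -comm_ab_sym.
  by apply: submodN; apply: comm_ab_mem_left.
(* The induction runs over elements of F, so the element w of [F, F] is quantified and tied to x by
   its value. *)
suff Nab x (w : derived_group F) : in_derived x -> val w = x -> (ab w : V) \in N.
  by rewrite -[u]ab_repr; apply: (Nab _ _ (elimT (derivedP _) (valP (repr u)))).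
move=> Dx; elim: Dx w => {x} [x y||x y Dx IHx Dy IHy|x Dx IHx] w wE.
- by rewrite (_ : ab w = comm_ab x y) //; congr (ab _ : V); apply: val_inj.
- by rewrite (_ : ab w = 0) ?rpred0 //; congr (ab _ : V); apply: val_inj.
- pose wx : derived_group F := exist _ x (introT (derivedP x) Dx).
  pose wy : derived_group F := exist _ y (introT (derivedP y) Dy).
  have -> : w = (wx * wy)%g by apply: val_inj.
  by rewrite abM; apply: rpredD; [apply: IHx | apply: IHy].
- pose wx : derived_group F := exist _ x (introT (derivedP x) Dx).
  have -> : w = wx^-1%g by apply: val_inj.
  by rewrite abV; apply: submodN; apply: IHx.
Qed.

(** Indices count from 0, so i < k is the condition i <= k of the 1-based notation. *)
Definition comm_gens (k : nat) (u : V) : Prop :=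
  exists i j : 'I_n, (i < k)%N /\ u = comm_ab (gen i) (gen j).

Definition comm_filt (k : nat) : submodClosed V := span (comm_gens k).

Lemma comm_filt0 u : (u \in comm_filt 0) = (u == 0).
Proof.
apply/idP/eqP => [/spanP[//|a x y [i [j []]]]|->]; first by rewrite ltn0.
exact: rpred0.
Qed.

Lemma comm_filtS k : {subset comm_filt k <= comm_filt k.+1}.
Proof.
apply: span_sub => u [i [j [ik ->]]]; apply: mem_span.
by exists i, j; rewrite ltnS ltnW.
Qed.

Lemma mem_comm_filt k (i j : 'I_n) :
  (i < k)%N || (j < k)%N -> comm_ab (gen i) (gen j) \in comm_filt k.
Proof.
case/orP => [ik|jk]; first by apply: mem_span; exists i, j.
by rewrite comm_ab_sym submodN //; apply: mem_span; exists j, i.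
Qed.

(** At most one index is >= k, so a commutator of generators not covered by [mem_comm_filt] has i =
    j and is trivial. *)
Lemma comm_filt_full k u : (n <= k.+1)%N -> u \in comm_filt k.
Proof.
move=> nk; apply: derived_ab_mem => i j.
have [jk|kj] := ltnP j k; first by rewrite mem_comm_filt // jk orbT.
have [ik|ki] := ltnP i k; first by rewrite mem_comm_filt // ik.
rewrite (_ : i = j) ?comm_ab_eq0 ?commgg ?rpred0 //.
apply/val_inj/eqP; rewrite eqn_leq.
by rewrite !(leq_trans _ ki, leq_trans _ kj) // -ltnS (leq_trans (ltn_ord _)).
Qed.

(* By the Hall-Witt identity, x_l acts trivially modulo comm_filt k for l < k. *)
Lemma comm_filt_act k (v : 'rV[int]_n) (i j : 'I_n) :
    (forall l : 'I_n, (k <= l)%N -> v 0 l = 0) ->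
  gr_basis v *: comm_ab (gen i) (gen j) - comm_ab (gen i) (gen j)
    \in comm_filt k.
Proof.
move=> v0; set c := comm_ab _ _.
pose P u := gr_basis u *: c - c \in comm_filt k.
have PB u w : P u -> P w -> P (u - w) by exact: scale_gr_basis_subB.
have P0 : P 0 by rewrite /P scale_gr_basis0 subrr rpred0.
apply: (int_row_ind P0 PB _ v0) => l lk.
(* The Hall-Witt identity involves x_l^-1, so P is established for the negated basis vector. *)
rewrite -[delta_mx 0 l]opprK -[- _]sub0r; apply: PB P0 _.
rewrite -(exponents_gen l); apply: mem_scale_gr_basisB1.
rewrite (comm_ab_jacobi (gen i) (gen l) (gen j)).
by apply: rpredD; apply: rpredZ; rewrite mem_comm_filt ?lk ?orbT.
Qed.
End Filtration.

(** * The graded pieces of the filtration *)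

Section Graded.
Variables k q : nat.
(** This form of n splits the generators into the first k, the one of index k ([top_index]) and the
    last q ([low_index]). The piece studied is M_(k+1) / M_k, of rank q over Z[Z^(q+1)]. *)
Local Notation n := (k + q.+1)%N.
Local Notation V := (free_derived_ab n).
Local Notation W := (last_group_ring n q.+1).

Lemma row_mx0K : cancel (row_mx (0 : 'rV[int]_k)) (@last_coords n q.+1).
Proof.
move=> v; apply/rowP => i; rewrite (@last_coordsE _ _ _ i (rshift k i)).
  exact: row_mxEr.
by rewrite /= addnK.
Qed.

Lemma last_coords_eq0 (v : 'rV[int]_n) (l : 'I_n) :
  last_coords q.+1 v = 0 -> (k <= l)%N -> v 0 l = 0.
Proof.
move=> v0; case: (split_ordP l) => i -> /=; first by rewrite leqNgt ltn_ord.
move=> _; move/rowP/(_ i): v0.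
rewrite (@last_coordsE _ _ _ i (rshift k i)) ?mxE //.
by rewrite /= addnK.
Qed.

Lemma last_coords_delta_lshift (i : 'I_k) :
  last_coords q.+1 (delta_mx 0 (lshift q.+1 i) : 'rV[int]_n) = 0.
Proof.
apply/rowP => j; rewrite (@last_coordsE _ _ _ j (rshift k j)) ?mxE /= ?addnK //.
by rewrite eq_rlshift.
Qed.

Lemma last_coords_delta_rshift (i : 'I_q.+1) :
  last_coords q.+1 (delta_mx 0 (rshift k i) : 'rV[int]_n) = delta_mx 0 i.
Proof.
apply/rowP => j; rewrite (@last_coordsE _ _ _ j (rshift k j)) ?mxE /= ?addnK //.
by rewrite eq_rshift.
Qed.

Definition top_index : 'I_n := rshift k ord0.
Definition low_index (j : 'I_q) : 'I_n := rshift k (lift ord0 j).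

Definition top_comm (j : 'I_q) : V :=
  comm_ab (gen top_index) (gen (low_index j)).

(* The Fox derivative with respect to the generator of index k + 1 + j. *)
Definition partial (j : 'I_q) : {linear V -> W} :=
  fox_ab (fun i => (if i == low_index j then 1 else 0) : W).

Lemma partial_comm j (i l : 'I_n) :
  gr_basis (exponents (gen l * gen i)%g) *: partial j (comm_ab (gen i) (gen l)) =
  (gr_basis (last_coords q.+1 (delta_mx 0 i : 'rV[int]_n)) - 1) *
    (if l == low_index j then 1 else 0) -
  (gr_basis (last_coords q.+1 (delta_mx 0 l : 'rV[int]_n)) - 1) *
    (if i == low_index j then 1 else 0) :> group_ring 'rV[int]_q.+1.
Proof.
have E := fox_comm (fun t => (if t == low_index j then 1 else 0) : W)
  (gen i) (gen l).
rewrite !exponents_gen !fox_gen in E; refine (etrans E _).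
apply: (congr2 (fun a b : group_ring 'rV[int]_q.+1 => a - b));
  exact: restriction_gr_basisB1.
Qed.

(** For i < k, x_i becomes 1 in Z[Z^(q+1)] and is not the variable of differentiation, so both terms
    of [partial_comm] vanish. *)
Lemma partial_filt0 j u : u \in comm_filt n k -> partial j u = 0.
Proof.
move=> /spanP; elim=> [|a x y [i [l [ik ->]]] _ IHy]; first exact: raddf0.
rewrite linearP IHy addr0 (_ : partial j _ = 0) ?scaler0 //.
apply: (@scale_gr_basis_eq0 _ W (exponents (gen l * gen i)%g)).
refine (etrans (partial_comm j i l) _).
have -> : (i == low_index j) = false.
  by apply/negbTE/eqP => ij; move: ik; rewrite ij /= ltnNge leq_addr.
apply: sub1_mul_eq0; have -> : i = lshift q.+1 (Ordinal ik) by apply: val_inj.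
by rewrite last_coords_delta_lshift.
Qed.

(** Here [delta_mx 0 0] is the image of the exponent of the generator [top_index], the first of the
    last q + 1 coordinates. *)
Lemma partial_top_comm j l :
  gr_basis (exponents (gen (low_index l) * gen top_index)%g) *:
    partial j (top_comm l) =
  if l == j then gr_basis (delta_mx 0 0) - 1 else 0
    :> group_ring 'rV[int]_q.+1.
Proof.
refine (etrans (partial_comm j top_index (low_index l)) _).
have -> : (top_index == low_index j) = false by rewrite eq_rshift.
have -> : (low_index l == low_index j) = (l == j).
  by rewrite eq_rshift (inj_eq lift_inj).
by rewrite last_coords_delta_rshift; apply: mulr_if_sub0.
Qed.

Lemma partial_top_comm_neq j l : l != j -> partial j (top_comm l) = 0.
Proof.
move=> /negPf lj.
apply: (@scale_gr_basis_eq0 _ W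
  (exponents (gen (low_index l) * gen top_index)%g)).
by refine (etrans (partial_top_comm j l) _); rewrite lj.
Qed.

Lemma delta_mx0_mulrn_inj :
  injective (fun i : nat => (delta_mx 0 0 : 'rV[int]_q.+1) *+ i).
Proof.
move=> i j /rowP/(_ 0); rewrite !mulmxnE !mxE /= => /eqP.
by rewrite !natz => /eqP[].
Qed.

Lemma top_comm_free r j :
  lin_comb top_comm r \in comm_filt n k -> gr_map (@last_coords n q.+1) (r j) = 0.
Proof.
move=> /(partial_filt0 j) E.
have {E} : r j *: partial j (top_comm j) = 0.
  rewrite -[RHS]E raddf_sum (bigD1 j) //= big1 ?addr0 => [|l lj].
    by rewrite linearZ.
  by rewrite linearZ partial_top_comm_neq //; apply: scaler0.
(* Multiplying by this unit turns the factor of r_j into exactly [delta_0] - 1, which can be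
   cancelled. *)
move=> /(scaler_comm_eq0
  (gr_basis (exponents (gen (low_index j) * gen top_index)%g))) E.
apply: gr_basis_sub1_reg delta_mx0_mulrn_inj _; rewrite mulrC.
apply: etrans _ E; congr (_ * _); apply: esym.
by refine (etrans (partial_top_comm j j) _); rewrite eqxx.
Qed.

(** Vectors killed by the projection involve only the first k coordinates, which act trivially
    modulo M_k; padding by zeros is the section. *)
Lemma top_comm_scale r j :
  gr_map (@last_coords n q.+1) r = 0 -> r *: top_comm j \in comm_filt n k.
Proof.
apply: (gr_map_ker_scale row_mx0K) => v v0; apply: comm_filt_act => l.
exact: last_coords_eq0.
Qed.

Lemma top_comm_gen (u : V) :
  u \in comm_filt n k.+1 -> exists r, lin_comb top_comm r - u \in comm_filt n k.
Proof.
move=> /spanP; elim=> [|a x y [i [l [ik ->]]] _ [s Ns]].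
  by exists 0; rewrite raddf0 subrr rpred0.
suff [r Nr] : exists r, lin_comb top_comm r - comm_ab (gen i) (gen l)
    \in comm_filt n k.
  exists (a *: r + s); rewrite linearP opprD addrACA -scalerBr.
  by apply: rpredD Ns; apply: rpredZ.
have N0 : comm_ab (gen i) (gen l) \in comm_filt n k ->
    exists r, lin_comb top_comm r - comm_ab (gen i) (gen l) \in comm_filt n k.
  by move=> Nil; exists 0; rewrite raddf0 sub0r submodN.
have [lk|kl] := ltnP l k; first by apply: N0; rewrite mem_comm_filt // lk orbT.
have [ik'|ki] := ltnP i k; first by apply: N0; rewrite mem_comm_filt // ik'.
have {ik ki} -> : i = top_index.
  by apply: val_inj; apply/eqP; rewrite /= addn0 eqn_leq ki -ltnS ik.
case: (split_ordP l) kl => m -> /=; first by rewrite leqNgt ltn_ord.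
(* Now l = k + m: either m = j + 1 and the commutator is [top_comm j], or m = 0 and it is [x_k, x_k]
   = 1. *)
move=> _; case: (unliftP ord0 m) => [j|] ->.
  exists [ffun t => if t == j then 1 else 0].
  by rewrite lin_comb_delta scale1r subrr; apply: rpred0.
exists 0; rewrite raddf0 comm_ab_eq0 ?commgg // subrr; exact: rpred0.
Qed.

Lemma comm_filt_graded :
  lmod_iso (subquotient (comm_filt n k.+1) (comm_filt n k)) {ffun 'I_q -> W}.
Proof.
apply: (@subquotient_iso _ _ (gr_map (@last_coords n q.+1)) _ _ _ _ top_comm).
- by move=> j; apply: mem_comm_filt; rewrite /= addn0 ltnSn.
- exact: top_comm_gen.
- move=> r; split=> [Nr j|r0]; first exact: top_comm_free.
  by apply: rpred_sum => j _; apply: top_comm_scale (r0 j).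
- exact/gr_map_surj/row_mx0K.
Qed.
End Graded.

Theorem theorem5 (n : nat) (n_ge1 : (1 <= n)%N) :
  exists M : nat -> submodClosed (free_derived_ab n),
    [/\ forall x : free_derived_ab n, (x \in M 0%N) = (x == 0),
        forall x : free_derived_ab n, x \in M (n - 1)%N,
        forall k : nat, (1 <= k <= n - 1)%N -> {subset M (k - 1)%N <= M k}
      & forall k : nat, (1 <= k <= n - 1)%N ->
          lmod_iso (subquotient (M k) (M (k - 1)%N))
                   {ffun 'I_(n - k) -> last_group_ring n (n - k + 1)}].
Proof.
exists (comm_filt n); split=> [||[//|k] _|[//|k] /andP[_ kn]].
- exact: comm_filt0.
- by move=> x; apply: comm_filt_full; rewrite subn1 (leq_trans (leqSpred n)).
- by rewrite subn1; apply: comm_filtS.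
(* The index of the statement is now k + 1, so the rank is q = n - (k + 1) and the group is
   Z^(q+1). *)
have [q nE] : exists q, n = (k + q.+1)%N.
  exists (n - k.+1)%N; rewrite addnS -addSn subnKC //.
  by rewrite (leq_trans kn) ?leq_subr.
have qE : (n - k.+1 = q)%N by rewrite nE addnS -addSn addKn.
rewrite qE addn1 subn1 /=; rewrite {}nE in n_ge1 kn qE *.
exact: comm_filt_graded.
Qed.
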